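(* Let $n\ge2$ and $1\le k\le n-1$. Identify each vertex $v\in\mathcal F_{n,k}$ of $\mathcal D^\ast_{n,k}$ with the variable $x_{\Psi(v)}$. Then the Stanley–Reisner ideal of $\mathcal D^\ast_{n,k}$ in the polynomial ring $\mathbb K[x_{\Psi(v)}: v\in\mathcal F_{n,k}]$ is generated by the monomials $$m_{A,B}=\prod_{(i,j)\in N(A,B)}x_{ij},\qquad A,B\subseteq[n],\ |A|=|B|=k+1.$$
   Context: Label the vertices of a convex regular $2n$-gon by $1,\dots,2n$ in cyclic order. A segment is a $2$-subset $\{a,b\}\subseteq[2n]$. Two segments cross if their four endpoints are distinct and interleave in the cyclic order. A $(k+1)$-crossing is a set of $k+1$ pairwise crossing segments. The cyclic length of $\{a,b\}$ is $\min(|a-b|,2n-|a-b|)$, and $\Omega_{2n,k}$ is the set of segments of cyclic length $>k$. The $180^\circ$-rotation sends $\{a,b\}$ to $\{a+n,b+n\}$ (indices mod $2n$). $\mathcal F_n$ is the set of rotation orbits of all segments, and $\mathcal F_{n,k}\subseteq\mathcal F_n$ is the set of orbits of segments in $\Omega_{2n,k}$. $\mathcal D^\ast_{n,k}$ is the simplicial complex on $\mathcal F_{n,k}$ whose faces are the sets of orbits whose union contains no $(k+1)$-crossing. Throughout, ''$m \bmod n$'' denotes the representative in $\{1,\dots,n\}$ (so $n\bmod n=n$). The bijection $\Psi:\mathcal F_n\to[n]\times[n]$ sends an orbit to $((a+1)\bmod n,\ b\bmod n)$ if $b-a\le n$, and to $((b+1)\bmod n,\ a\bmod n)$ if $b-a>n$,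 where $\{a<b\}$ is any segment in the orbit (the value does not depend on this choice). For $s\ge1$ and $A=\{a_1<\dots<a_s\}$, $B=\{b_1<\dots<b_s\}\subseteq[n]$, let $\ell$ be the least integer $0\le\ell\le s$ such that $a_{i+\ell}>b_i$ for all $1\le i\le s-\ell$. Then set $N(A,B)=\{(a_{(i+\ell)\bmod s},b_i): i=1,\dots,s\}$, with $\bmod s$ taking values in $\{1,\dots,s\}$. *)

(* Defs.v *)
From HB Require Import structures.
From mathcomp Require Import all_boot all_order all_algebra.
From mathcomp Require Import zify.
From mathcomp Require Export mpoly.

Set Implicit Arguments.
Unset Strict Implicit.
Unset Printing Implicit Defensive.

Import GRing.Theory.
Local Open Scope nat_scope.

(* Ordinals are 0-based: i : 'I_(2 * n) stands for the vertex labelled i + 1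
   and i : 'I_n for the element i + 1 of [n].  Crossings, cyclic lengths, the
   rotation, Psi and N(A, B) are all given by the same formulas in 0-based and
   in 1-based labels: shifting every label by one turns "mod n with values in
   {1, ..., n}" into the usual remainder in {0, ..., n - 1}. *)

Section Polygon.
Variable n : nat.

Local Notation vtx := 'I_(2 * n).

Lemma vtx_gt0 (a : vtx) : 0 < 2 * n.
Proof. exact: leq_ltn_trans (leq0n a) (ltn_ord a). Qed.

Lemma vtx_half_gt0 (a : vtx) : 0 < n.
Proof. by have := vtx_gt0 a; rewrite muln_gt0. Qed.

Definition segments : {set {set vtx}} := [set S : {set vtx} | #|S| == 2].

Definition cross (S T : {set vtx}) : bool :=
  [exists a : vtx, exists b : vtx, exists c : vtx, exists d : vtx,
    [&& a < c, c < b, b < d &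
      (S == [set a; b]) && (T == [set c; d]) ||
      (S == [set c; d]) && (T == [set a; b])]].

Definition crossing (m : nat) (X : {set {set vtx}}) : bool :=
  [&& X \subset segments, #|X| == m &
    [forall S in X, forall T in X, (S != T) ==> cross S T]].

Definition cyclic_length (a b : vtx) : nat :=
  let d := maxn a b - minn a b in minn d (2 * n - d).

Definition Omega (k : nat) : {set {set vtx}} :=
  [set S in segments |
    [exists a, exists b, (S == [set a; b]) && (k < cyclic_length a b)]].

Definition rotate (a : vtx) : vtx := Ordinal (ltn_pmod (a + n) (vtx_gt0 a)).

Definition seg_orbit (S : {set vtx}) : {set {set vtx}} :=
  [set S; rotate @: S].

Definition F : Type := {O : {set {set vtx}} | O \in seg_orbit @: segments}.
HB.instance Definition _ := SubFinite.on F.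

Definition Fk (k : nat) : {set F} := [set O | val O \in seg_orbit @: Omega k].

Definition Fk_vertex (k : nat) : Type := {v : F | v \in Fk k}.
HB.instance Definition _ k := SubFinite.on (Fk_vertex k).

Definition Dstar (k : nat) : {set {set Fk_vertex k}} :=
  [set E : {set Fk_vertex k} |
    ~~ [exists X : {set {set vtx}},
          (X \subset \bigcup_(v in E) val (val v)) && crossing k.+1 X]].

Definition modo (a : vtx) (m : nat) : 'I_n :=
  Ordinal (ltn_pmod m (vtx_half_gt0 a)).

Definition psi (a b : vtx) : 'I_n * 'I_n :=
  if b - a <= n then (modo a a.+1, modo a b) else (modo a b.+1, modo a a).

Definition seg_in (O : F) (ab : vtx * vtx) : bool :=
  (ab.1 < ab.2) && ([set ab.1; ab.2] \in val O).

Lemma seg_inP (O : F) : exists ab, seg_in O ab.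
Proof.
case: O => O OS; rewrite /seg_in /=.
have [S] := imsetP OS; rewrite inE => /cards2P[a [b [ab SE]]] ->; rewrite {S}SE.
wlog lt_ab : a b ab / a < b => [H|].
  move: (ab); rewrite -val_eqE /= neq_ltn => /orP[/H|lt_ba]; first exact.
  by rewrite [[set a; b]]setUC; apply: H; rewrite 1?eq_sym.
by exists (a, b); rewrite /= lt_ab !inE eqxx.
Qed.

(* The value does not depend on the chosen segment: see PsiE. *)
Definition Psi (O : F) : 'I_n * 'I_n :=
  let ab := xchoose (seg_inP O) in psi ab.1 ab.2.

Definition elts (A : {set 'I_n}) : seq nat := [seq val i | i <- enum A].

Lemma elts_sorted (A : {set 'I_n}) : sorted ltn (elts A).
Proof.
rewrite /elts /enum_mem sorted_map.
have h : sorted (relpre val ltn) (Finite.enum 'I_n).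
  by rewrite -sorted_map -enumT val_enum_ord iota_ltn_sorted.
apply: subseq_sorted (filter_subseq _ _) h.
by move=> y x z /=; apply: ltn_trans.
Qed.

Definition shift_ok (A B : {set 'I_n}) (l : nat) : bool :=
  [forall i : 'I_(#|A| - l), nth 0 (elts B) i < nth 0 (elts A) (i + l)].

Definition shift (A B : {set 'I_n}) : nat :=
  [arg min_(l < (ord_max : 'I_(#|A|.+1)) | shift_ok A B l) (l : nat)].

(* Only meaningful for #|A| = #|B| > 0. *)
Definition N (A B : {set 'I_n}) : {set 'I_n * 'I_n} :=
  [set p : 'I_n * 'I_n | [exists i : 'I_#|A|,
     (val p.1 == nth 0 (elts A) ((i + shift A B) %% #|A|)) &&
     (val p.2 == nth 0 (elts B) i)]].

Definition var_index (k : nat) : Type :=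
  {p : 'I_n * 'I_n | p \in Psi @: Fk k}.
HB.instance Definition _ k := SubFinite.on (var_index k).

Definition Psi_vertex (k : nat) (v : Fk_vertex k) : var_index k :=
  exist _ (Psi (val v)) (imset_f Psi (valP v)).

Lemma set2_lt_inj (a b c d : vtx) :
  a < b -> c < d -> [set a; b] = [set c; d] -> a = c /\ b = d.
Proof.
move=> ab cd /setP e; split; apply: val_inj => /=;
have := e a; have := e b; have := e c; have := e d; rewrite !inE -!val_eqE /=; lia.
Qed.

Lemma psi_rotate (a b c d : vtx) : a < b -> c < d ->
  [set c; d] = rotate @: [set a; b] -> psi a b = psi c d.
Proof.
move=> ab cd; rewrite imsetU1 imset_set1 => /setP e.
have b2 := ltn_ord b.
have ra : val (rotate a) = if a < n then a + n else a - n.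
  rewrite /=; case: ifP => h; first by rewrite modn_small //; lia.
  by rewrite (_ : a + n = (a - n) + 2 * n) ?modnDr ?modn_small //; lia.
have rb : val (rotate b) = if b < n then b + n else b - n.
  rewrite /=; case: ifP => h; first by rewrite modn_small //; lia.
  by rewrite (_ : b + n = (b - n) + 2 * n) ?modnDr ?modn_small //; lia.
have cdE : (c == rotate a :> nat) && (d == rotate b :> nat)
        || (c == rotate b :> nat) && (d == rotate a :> nat).
  have := e c; have := e d; have := e (rotate a); have := e (rotate b).
  by rewrite !inE -!val_eqE /=; lia.
have modE x y : (x = y + n \/ y = x + n \/ x = y) -> x %% n = y %% n.
  by case=> [->|[->|->]//]; rewrite modnDr.
move: cdE ra rb; case: (rotate a) => ra' ra2; case: (rotate b) => rb' rb2 /=.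
move=> cdE ra rb.
rewrite /psi; do 2 case: ifP => ?; congr pair; apply: val_inj; apply: modE;
move: ra rb; do 2 case: ifP => ?; lia.
Qed.

Lemma PsiE (O : F) (a b : vtx) :
  a < b -> [set a; b] \in val O -> Psi O = psi a b.
Proof.
move=> ab abO; rewrite /Psi; have := xchooseP (seg_inP O).
case: (xchoose _) => c d /andP[/= cd cdO]; move: abO cdO.
case: O => O /= /imsetP[S _ ->]; rewrite !inE.
case/orP=> /eqP e1 /orP[]/eqP e2.
- by have [-> ->] := set2_lt_inj ab cd (etrans e1 (esym e2)).
- by rewrite -(psi_rotate ab cd) // e2 e1.
- by rewrite (psi_rotate cd ab) // e1 e2.
- by have [-> ->] := set2_lt_inj ab cd (etrans e1 (esym e2)).
Qed.

End Polygon.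

Section Ideals.
Local Open Scope ring_scope.

Definition ideal_gen (R : comPzRingType) (G : R -> Prop) (p : R) : Prop :=
  exists s : seq (R * R),
    (forall c, c \in s -> G c.2) /\ p = \sum_(c <- s) c.1 * c.2.

(* The map x identifies the vertices of the complex with the variables. *)
Definition stanley_reisner (V : finType) (Delta : {set {set V}})
    (R : comPzRingType) (x : V -> R) : R -> Prop :=
  ideal_gen (fun m => exists2 E : {set V}, E \notin Delta &
                        m = \prod_(v in E) x v).

Definition xvar (K : fieldType) (n k : nat) (w : var_index n k) :
  {mpoly K[#|{: var_index n k}|]} := 'X_(enum_rank w).

(* Ranges over the pairs of N A B that index a variable of the ring; when
   N A B \subset Psi @: Fk n k this is the product over all of N A B. *)
Definition mAB (K : fieldType) (n k : nat) (A B : {set 'I_n}) :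
    {mpoly K[#|{: var_index n k}|]} :=
  \prod_(w : var_index n k | val w \in N A B) xvar K w.

End Ideals.

(* Main.v *)
Require Import Defs.
From mathcomp Require Import all_boot all_order all_algebra.
From mathcomp Require Import zify.

(* Orient every segment along the arc of length at most n that it cuts off and
   lift it to a pair p < q <= p + n of natural numbers, so that Psi becomes
   (p + 1, q) mod n.  If p <= p' <= p + n, two such arcs cross exactly when
   p < p' < q < q'.  Extend A and B to increasing sequences a_i and b_i with
   a_(i+s) = a_i + n and b_(i+s) = b_i + n, where s = k + 1.  A shift l is
   admissible iff b_i < a_(i+l) for all i, which says that the arcs from
   a_(i+l) - 1 to b_i + n have length at most n.

   For the least admissible l > 0 there is an i with a_(i+l-1) <= b_i; then the
   starting points of the s consecutive arcs from index i on all precede their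
   end points, and these arcs cross pairwise and have length > k.

   Conversely, crossing forces the starting points and the end points of the
   arcs of a crossing X to be pairwise distinct mod n and the matching to be
   increasing, hence given by an admissible l.  If l - 1 were admissible too,
   consecutive arcs could only cross inside one and the same lift, so that X
   would contain an arc and its image under the half-turn; these never cross,
   so all arcs of X would be diameters, which contradicts the admissibility of
   l - 1. *)

Set Implicit Arguments.
Unset Strict Implicit.
Unset Printing Implicit Defensive.

Local Open Scope nat_scope.

(** * Pairs of points and residues in a window *)

Lemma set2_eqE (T : finType) (a b c d : T) :
  ([set a; b] == [set c; d]) = (a == c) && (b == d) || (a == d) && (b == c).
Proof.
apply/eqP/idP => [/setP e|]; last first.
  by case/orP=> /andP[/eqP-> /eqP->] //; rewrite setUC.
have := e a; have := e b; have := e c; have := e d; rewrite !inE !eqxx ?orbT /=.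
rewrite (eq_sym c a) (eq_sym c b) (eq_sym d a) (eq_sym d b).
by do 4 case: eqP => //=.
Qed.

Lemma modn_window m t x : t * m <= x < t * m + 2 * m ->
  x %% m = if x < t * m + m then x - t * m else x - t * m - m.
Proof.
move=> hx; case: ifP => h.
  by rewrite -{1}(subnKC (m := t * m) (n := x)) ?modnMDl ?modn_small; lia.
rewrite -{1}(subnKC (m := t.+1 * m) (n := x)) ?modnMDl ?modn_small; lia.
Qed.

(** * Segments as lifted arcs *)

Section Arcs.
Variable n : nat.

(* A segment is oriented as the arc of length at most n that it cuts off,
   lifted from Z/2n to the natural numbers. *)
Definition short_arc (p q : nat) : bool := p < q <= p + n.

Lemma short_arcD p q m : short_arc (p + m) (q + m) = short_arc p q.
Proof. by rewrite /short_arc; lia. Qed.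

Hypothesis n_gt0 : 0 < n.

Let n2_gt0 : 0 < 2 * n. Proof. by rewrite muln_gt0. Qed.

Definition vx (x : nat) : 'I_(2 * n) := Ordinal (ltn_pmod x n2_gt0).

Definition seg (p q : nat) : {set 'I_(2 * n)} := [set vx p; vx q].

Lemma cross_set2 (a b c d : 'I_(2 * n)) :
  cross [set a; b] [set c; d] =
    [&& minn a b < minn c d, minn c d < maxn a b & maxn a b < maxn c d] ||
    [&& minn c d < minn a b, minn a b < maxn c d & maxn c d < maxn a b].
Proof.
apply/idP/idP => [/existsP[x /existsP[y /existsP[z /existsP[t]]]]|].
  by rewrite !set2_eqE -!val_eqE /=; lia.
wlog ab : a b / a <= b => [H|].
  case/orP: (leq_total a b) => [/H//|ba].
  by rewrite (minnC a) (maxnC a) [[set a; b]]setUC; apply: H.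
wlog cd : c d / c <= d => [H|].
  case/orP: (leq_total c d) => [/H//|dc].
  by rewrite (minnC c) (maxnC c) [[set c; d]]setUC; apply: H.
move=> H; have [h|h] := ltnP a c.
  by apply/existsP; exists a; apply/existsP; exists b; apply/existsP; exists c;
     apply/existsP; exists d; rewrite !set2_eqE !eqxx /=; lia.
by apply/existsP; exists c; apply/existsP; exists d; apply/existsP; exists a;
   apply/existsP; exists b; rewrite !set2_eqE !eqxx ?orbT /=; lia.
Qed.

(** Two arcs with [p <= p' <= p + n] have all end points in [p, p + 2n]. There reduction mod [2 * n]
    subtracts one common multiple and wraps at most once, which leaves a linear case analysis. *)
Lemma vx_window p x : p <= x < p + 2 * n + 1 ->
  vx x = (if x < p %/ (2 * n) * (2 * n) + 2 * n then x - p %/ (2 * n) * (2 * n)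
          else x - p %/ (2 * n) * (2 * n) - 2 * n) :> nat.
Proof.
move=> h; rewrite /= (@modn_window _ (p %/ (2 * n))) //.
have := divn_eq p (2 * n); have := ltn_pmod p n2_gt0; lia.
Qed.

Lemma cross_seg p q p' q' : short_arc p q -> short_arc p' q' -> p <= p' <= p + n ->
  cross (seg p q) (seg p' q') = [&& p < p', p' < q & q < q'].
Proof.
rewrite /short_arc => pq pq' pp; rewrite cross_set2.
rewrite !(@vx_window p); try lia.
have := divn_eq p (2 * n); have := ltn_pmod p n2_gt0.
move: (p %/ _ * _) (p %% _) => u r.
move=> r_lt pE; have -> : p < u + 2 * n by lia.
do 3 (case: ifP => ?; try (exfalso; lia)).
all: match goal with |- context [minn ?x ?y] => case: (leqP x y) => ? end;
  try (exfalso; lia).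
all: match goal with |- context [minn ?x ?y] => case: (leqP x y) => ? end;
  try (exfalso; lia).
all: by apply/idP/idP; lia.
Qed.

(** The second disjunct is a diameter: it cuts off arcs of length [n] on both sides, so a lift can
    start at either end. *)
Lemma seg_eq p q p' q' : short_arc p q -> short_arc p' q' -> p <= p' <= p + n ->
  (seg p q == seg p' q') =
    (p == p') && (q == q') || [&& p' == p + n, q == p + n & q' == p + 2 * n].
Proof.
rewrite /short_arc => pq pq' pp; rewrite set2_eqE -!val_eqE.
change (\val (vx p)) with (vx p : nat); change (\val (vx q)) with (vx q : nat).
change (\val (vx p')) with (vx p' : nat); change (\val (vx q')) with (vx q' : nat).
rewrite !(@vx_window p); try lia.
have := divn_eq p (2 * n); have := ltn_pmod p n2_gt0.
move: (p %/ _ * _) (p %% _) => u r.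
move=> r_lt pE; have -> : p < u + 2 * n by lia.
do 3 (case: ifP => ?; try (exfalso; lia)).
all: by apply/idP/orP => [/orP[]/andP[/eqP e1 /eqP e2]|
    [/andP[/eqP e1 /eqP e2]|/and3P[/eqP e1 /eqP e2 /eqP e3]]]; first
  [ by exfalso; lia | by left; apply/andP; split; apply/eqP; lia
  | by right; apply/and3P; split; apply/eqP; lia
  | by apply/orP; left; apply/andP; split; apply/eqP; lia
  | by apply/orP; right; apply/andP; split; apply/eqP; lia].
Qed.

Lemma segC p q : seg p q = seg q p. Proof. exact: setUC. Qed.

Lemma seg_ord (a b : 'I_(2 * n)) : seg a b = [set a; b].
Proof. by congr [set _; _]; apply: val_inj; rewrite /= modn_small. Qed.

Lemma seg_period p q : seg (p + 2 * n) (q + 2 * n) = seg p q.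
Proof. by congr [set _; _]; apply: val_inj; rewrite /= modnDr. Qed.

Lemma seg_rotate p q : @rotate n @: seg p q = seg (p + n) (q + n).
Proof.
rewrite imsetU1 imset_set1.
by congr [set _; _]; apply: val_inj; rewrite /= modnDml.
Qed.

Lemma segmentP (S : {set 'I_(2 * n)}) : S \in segments n ->
  exists p q, [/\ p < 2 * n, short_arc p q & S = seg p q].
Proof.
rewrite inE => /cards2P[a [b [ab ->]]].
wlog lt_ab : a b ab / a < b => [H|].
  move: (ab); rewrite -val_eqE /= neq_ltn => /orP[/H|lt_ba]; first exact.
  by rewrite [[set a; b]]setUC; apply: H; rewrite 1?eq_sym.
have [le_ab|le_ab] := leqP (b - a) n.
  exists a, b; split=> //; first by rewrite /short_arc; lia.
  by rewrite seg_ord.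
exists b, (a + 2 * n); split=> //; first by rewrite /short_arc; have := ltn_ord b; lia.
rewrite -seg_ord segC; congr [set _; _].
by apply: val_inj; rewrite /= modnDr.
Qed.

Lemma vx_neq p q : short_arc p q -> vx p != vx q.
Proof.
rewrite /short_arc => pq; rewrite -val_eqE.
change (\val (vx p)) with (vx p : nat); change (\val (vx q)) with (vx q : nat).
rewrite !(@vx_window p); try lia.
have := divn_eq p (2 * n); have := ltn_pmod p n2_gt0.
move: (p %/ _ * _) (p %% _) => u r.
by do 2 (case: ifP => ?; try (exfalso; lia)); lia.
Qed.

Lemma seg_segments p q : short_arc p q -> seg p q \in segments n.
Proof. by move=> pq; rewrite inE cards2 vx_neq. Qed.

Lemma seg_Omega k p q : short_arc p q -> k < q - p -> seg p q \in Omega n k.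
Proof.
move=> pq kpq; rewrite inE seg_segments //=.
apply/existsP; exists (vx p); apply/existsP; exists (vx q); rewrite eqxx /=.
move: pq; rewrite /short_arc /cyclic_length => pq.
rewrite !(@vx_window p); try lia.
have := divn_eq p (2 * n); have := ltn_pmod p n2_gt0.
move: (p %/ _ * _) (p %% _) => u r.
by do 2 (case: ifP => ?; try (exfalso; lia)); lia.
Qed.

Lemma Psi_seg (O : F n) p q : short_arc p q -> seg p q \in val O ->
  ((Psi O).1 = p.+1 %% n :> nat) /\ ((Psi O).2 = q %% n :> nat).
Proof.
move=> pq pqO.
have m2 x : (vx x : nat) = x %[mod n] by rewrite /= modn_dvdm // dvdn_mull.
have m2S x : (vx x).+1 = x.+1 %[mod n].
  by apply/eqP; rewrite -[x.+1]addn1 -[(vx x).+1]addn1 eqn_modDr; apply/eqP/m2.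
(* Either the reduced arc does not wrap and [psi] takes its first branch, or it wraps and [psi]
   takes its second. A wrapping diameter falls under the first branch, where exchanging its ends
   changes nothing mod [n]. *)
have W : ((vx p < vx q) && (vx q - vx p <= n)) ||
         ((vx q < vx p) && ((vx p - vx q > n) || (vx p - vx q == n)
                            && (q == p + n))).
  have lt_neq : (vx p < vx q) || (vx q < vx p).
    by have := vx_neq pq; rewrite -val_eqE neq_ltn.
  move: pq lt_neq; rewrite /short_arc => pq.
  rewrite !(@vx_window p); try lia.
  have := divn_eq p (2 * n); have := ltn_pmod p n2_gt0.
  move: (p %/ _ * _) (p %% _) => u r.
  by do 2 (case: ifP => ?; try (exfalso; lia)); lia.
case/orP: W => /andP[lt W].
  by rewrite (PsiE lt pqO) /psi W -(m2 q) -(m2S p).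
have pqO' : [set vx q; vx p] \in val O by rewrite setUC.
rewrite (PsiE lt pqO') /psi; case: ifP W => [le|_ _] /=.
  rewrite ltnNge le /= => /andP[_ /eqP ->].
  split; first by apply: etrans (m2S (p + n)) _; rewrite -addSn modnDr.
  by apply: etrans (m2 p) _; rewrite modnDr.
by rewrite -(m2 q) -(m2S p).
Qed.

End Arcs.

Lemma modnDMr p m d : (m + p * d) %% d = m %% d.
Proof. by rewrite addnC modnMDl. Qed.

(** * Periodic enumeration of a subset of [n] *)

Section PeriodicExtension.
Variables (n : nat) (A : {set 'I_n}).
Hypothesis A_gt0 : 0 < #|A|.

(* The i-th smallest natural number that is congruent mod n to an element
   of A. *)
Definition pext (i : nat) : nat :=
  nth 0 (elts A) (i %% #|A|) + n * (i %/ #|A|).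

Lemma size_elts : size (elts A) = #|A|.
Proof. by rewrite /elts size_map -cardE. Qed.

Lemma mem_elts (x : 'I_n) : (val x \in elts A) = (x \in A).
Proof. by rewrite /elts mem_map ?mem_enum //; apply: val_inj. Qed.

Lemma nth_elts i : i < #|A| -> exists2 x : 'I_n, x \in A & nth 0 (elts A) i = x.
Proof.
move=> iA; have : nth 0 (elts A) i \in elts A by rewrite mem_nth ?size_elts.
by case/mapP => x; rewrite mem_enum => xA ->; exists x.
Qed.

Lemma pext_small i : i < #|A| -> pext i = nth 0 (elts A) i.
Proof. by move=> h; rewrite /pext modn_small // divn_small // muln0 addn0. Qed.

Lemma pextD i : pext (i + #|A|) = pext i + n.
Proof. by rewrite /pext modnDr divnDr ?dvdnn // divnn A_gt0 mulnDr muln1 addnA. Qed.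

Lemma pextDM i t : pext (i + t * #|A|) = pext i + t * n.
Proof.
elim: t => [|t IH]; first by rewrite !mul0n !addn0.
by rewrite !mulSn (addnC #|A|) addnA pextD IH; lia.
Qed.

Lemma pext_mod i : exists2 x : 'I_n, x \in A & pext i %% n = x.
Proof.
have [|x xA E] := @nth_elts (i %% #|A|); first by rewrite ltn_pmod.
by exists x => //; rewrite /pext E mulnC modnDMr modn_small.
Qed.

Lemma pext_bound i : n * (i %/ #|A|) <= pext i < n * (i %/ #|A|) + n.
Proof.
have [|x _ E] := @nth_elts (i %% #|A|); first by rewrite ltn_pmod.
by rewrite /pext E; have := ltn_ord x; lia.
Qed.

Lemma pext_ltS i : pext i < pext i.+1.
Proof.
rewrite (divn_eq i #|A|) addnC -addSn !pextDM ltn_add2r.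
have : i %% #|A| < #|A| by rewrite ltn_pmod.
move: (i %% #|A|) => r; rewrite leq_eqVlt => /orP[/eqP rA|rA].
  rewrite rA -[#|A|]add0n pextD.
  have := pext_bound r; rewrite divn_small ?rA //; lia.
rewrite !pext_small //; last exact: ltnW.
by rewrite (sorted_ltn_nth ltn_trans 0 (elts_sorted A)) ?inE ?size_elts //; lia.
Qed.

Lemma pext_addl i d : pext i + d <= pext (i + d).
Proof.
elim: d => [|d IH]; first by rewrite !addn0.
by have := pext_ltS (i + d); rewrite !addnS; lia.
Qed.

Lemma pext_lt i j : (pext i < pext j) = (i < j).
Proof.
have lt a b : a < b -> pext a < pext b.
  by move=> ab; have := pext_addl a (b - a); rewrite (subnKC (ltnW ab)); lia.
have [|ji] := ltnP i j; first exact: lt.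
by move: ji; rewrite leq_eqVlt => /orP[/eqP->|/lt]; lia.
Qed.

Lemma pext_inj : injective pext.
Proof.
move=> i j E; have := pext_lt i j; have := pext_lt j i.
by rewrite E ltnn; case: ltngtP.
Qed.

Lemma pext_surj m : 0 < n -> (exists2 x : 'I_n, x \in A & m %% n = x) ->
  exists i, pext i = m.
Proof.
move=> n_gt0 [x xA mx]; move: (xA); rewrite -mem_elts => xe.
have lt_i : index (val x) (elts A) < #|A| by rewrite -size_elts index_mem.
exists (index (val x) (elts A) + m %/ n * #|A|).
rewrite pextDM pext_small // nth_index // [RHS](divn_eq m n) addnC.
by rewrite mx.
Qed.

End PeriodicExtension.

(** * Admissible shifts on periodic enumerations *)

Section Shift.
Variables (n s : nat) (A B : {set 'I_n}).
Hypotheses (s_gt0 : 0 < s) (cardA : #|A| = s) (cardB : #|B| = s).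

(** For [i < s <= i + l] the inequality is automatic, since [pext B i < n <= pext A (i + l)];
    periodicity then gives all [i]. *)
Lemma shift_okP l : l <= s ->
  reflect (forall i, pext B i < pext A (i + l)) (shift_ok A B l).
Proof.
move=> ls; have A0 : 0 < #|A| by rewrite cardA.
have B0 : 0 < #|B| by rewrite cardB.
apply: (iffP forallP) => [ok i|ok i]; last first.
  have := ltn_ord i; move=> lt_i; have := ok i; rewrite !pext_small //; lia.
rewrite (divn_eq i s); have : i %% s < s by rewrite ltn_pmod.
move: (i %/ s) (i %% s) => t r rs.
have -> : pext B (t * s + r) = pext B r + t * n by rewrite addnC -cardB pextDM.
have -> : pext A (t * s + r + l) = pext A (r + l) + t * n.
  by rewrite -addnA addnC -cardA pextDM.
rewrite ltn_add2r; have [h|h] := ltnP (r + l) s.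
  have rl : r < #|A| - l by lia.
  by rewrite !pext_small ?cardA ?cardB //; exact: (ok (Ordinal rl)).
have := pext_bound B0 r; rewrite divn_small ?cardB // => b.
have := pext_bound A0 (r + l); rewrite cardA => a.
have : 0 < (r + l) %/ s by rewrite divn_gt0.
move=> q; have : n <= n * ((r + l) %/ s) by rewrite leq_pmulr.
lia.
Qed.

Lemma shift_min : [/\ shift A B <= s, shift_ok A B (shift A B) &
  forall l, l < shift A B -> ~~ shift_ok A B l].
Proof.
rewrite /shift; case: arg_minnP => [|i ok min].
  by apply/forallP => -[i] /=; rewrite subnn.
split=> //; first by rewrite -ltnS -cardA.
move=> l li; apply/negP => okl.
have lA : l < #|A|.+1 by apply: ltn_trans li (ltn_ord i).
by have := min (Ordinal lA) okl; rewrite leqNgt li.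
Qed.

(** Raising an index by [s] adds [n] to [pext], so letting [i] range over all naturals absorbs the
    reduction of indices mod [s]. *)
Lemma N_pextP (w : 'I_n * 'I_n) :
  reflect (exists i, w.1 = pext A (i + shift A B) %% n :> nat /\
                     w.2 = pext B i %% n :> nat)
          (w \in N A B).
Proof.
have pmod (C : {set 'I_n}) i : #|C| = s -> pext C i %% n = nth 0 (elts C) (i %% s).
  move=> cC; have [|x _ E] := @nth_elts _ C (i %% s).
    by rewrite cC ltn_pmod.
  by rewrite /pext cC E mulnC modnDMr modn_small.
rewrite inE; apply: (iffP existsP) => [[i /andP[/eqP e1 /eqP e2]]|[i [e1 e2]]].
  exists i; rewrite !pmod // -cardA -e1; split=> //.
  by rewrite modn_small.
have lt_i : i %% s < #|A| by rewrite cardA ltn_pmod.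
exists (Ordinal lt_i); rewrite /=.
by rewrite e1 e2 !pmod // cardA modnDml !eqxx.
Qed.

End Shift.

(** * Families of pairwise crossing arcs *)

Lemma crossC n (S T : {set 'I_(2 * n)}) : cross S T = cross T S.
Proof.
rewrite /cross; do 4 apply: eq_existsb => ?.
by rewrite orbC; congr [&& _, _, _ & _ || _]; rewrite andbC.
Qed.

Lemma crossxx n (S : {set 'I_(2 * n)}) : cross S S = false.
Proof.
apply/negbTE/negP => /existsP[a /existsP[b /existsP[c /existsP[d]]]].
rewrite [X in _ || X]andbC orbb => /and4P[ac cb bd /andP[/eqP-> e]].
by move: e; rewrite set2_eqE -!val_eqE /=; lia.
Qed.

(** The last starting point precedes the first end point, so [P i < P j < Q i < Q j] for [i < j], as
    [cross_seg] requires. *)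
Lemma arcs_crossing n (n_gt0 : 0 < n) s (P Q : nat -> nat) :
  (forall j, j < s -> short_arc n (P j) (Q j)) ->
  {homo P : i j / i < j} -> {homo Q : i j / i < j} -> P s.-1 < Q 0 ->
  crossing s [set seg n_gt0 (P j) (Q j) | j : 'I_s].
Proof.
move=> arcPQ mP mQ PQ.
have cr (i j : 'I_s) : i < j ->
    cross (seg n_gt0 (P i) (Q i)) (seg n_gt0 (P j) (Q j)).
  move=> ij; have Pij := mP _ _ ij; have Qij := mQ _ _ ij.
  have hj := ltn_ord j.
  have Pj : P j <= P s.-1 by rewrite (ltnW_homo mP) //; lia.
  have Qi : Q 0 <= Q i by rewrite (ltnW_homo mQ).
  have ai := arcPQ _ (ltn_ord i); have aj := arcPQ _ (ltn_ord j).
  rewrite cross_seg //; move: ai aj; rewrite /short_arc; lia.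
have cr2 (i j : 'I_s) : i != j ->
    cross (seg n_gt0 (P i) (Q i)) (seg n_gt0 (P j) (Q j)).
  by rewrite -val_eqE neq_ltn => /orP[/cr//|/cr]; rewrite crossC.
apply/and3P; split.
- by apply/subsetP => _ /imsetP[j _ ->]; rewrite seg_segments ?arcPQ.
- rewrite card_imset ?card_ord // => i j e; apply/eqP/negPn/negP => /cr2.
  by rewrite e crossxx.
- apply/forall_inP => _ /imsetP[i _ ->]; apply/forall_inP => _ /imsetP[j _ ->].
  by apply/implyP => h; apply: cr2; apply: contraNneq h => ->.
Qed.

(** * A crossing with image N(A, B) *)

Section Crossing_of_N.
Variables (n k : nat) (n_gt0 : 0 < n) (A B : {set 'I_n}).
Hypotheses (cardA : #|A| = k.+1) (cardB : #|B| = k.+1).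

Lemma N_crossing : exists X : {set {set 'I_(2 * n)}},
  [/\ crossing k.+1 X, X \subset Omega n k,
      forall S (O : F n), S \in X -> S \in val O -> Psi O \in N A B &
      forall w, w \in N A B ->
        exists2 S, S \in X & forall O : F n, S \in val O -> Psi O = w].
Proof.
have A0 : 0 < #|A| by rewrite cardA.
have B0 : 0 < #|B| by rewrite cardB.
have [ls ok min] := shift_min B cardA.
set l := shift A B in ls ok min.
have {ok} ok := shift_okP (ltn0Sn k) cardA cardB ls ok.
(* For [l = 0] the first [k.+1] values of [pext A] are below [n]. For [l > 0] the failure of [l - 1]
   gives [i] with [pext A (i + l - 1) <= pext B i], and raising the index on the left by [k.+1] adds
   [n]. *)
have [i0 i0P] : exists i, pext A (i + l + k) <= pext B i + n.
  case lE: l => [|l'].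
    exists 0; have := pext_bound A0 (0 + 0 + k).
    by rewrite cardA divn_small; lia.
  have l's : l' <= k.+1 by lia.
  have [i hi] : exists i, pext A (i + l') <= pext B i.
    have : ~~ shift_ok A B l' by apply: min; rewrite lE.
    rewrite negb_forall => /existsP[i]; rewrite -leqNgt => hi.
    have hlt := ltn_ord i.
    by exists i; rewrite !pext_small //; lia.
  exists i; rewrite (_ : i + l'.+1 + k = i + l' + #|A|) ?pextD //; last by lia.
  by rewrite leq_add2r.
(* The predecessor undoes the [+ 1] in the first coordinate of [Psi]; [ok] makes [pext A] positive
   here, so nothing is truncated. Adding [n] to the end points keeps their residues. *)
pose P j := (pext A (i0 + j + l)).-1; pose Q j := pext B (i0 + j) + n.
have PE j : (P j).+1 = pext A (i0 + j + l).
  by rewrite /P prednK //; apply: leq_ltn_trans (ok _).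
have mP : {homo P : i j / i < j}.
  by move=> i j ij; rewrite -ltnS !PE pext_lt //; lia.
have mQ : {homo Q : i j / i < j}.
  by move=> i j ij; rewrite ltn_add2r pext_lt //; lia.
have PQ : P k < Q 0.
  by rewrite PE /Q addn0 (addnAC i0).
(* From [j] to [k] the starts grow by at least [k - j], from [0] to [j] the ends by at least [j],
   and [P k < Q 0]. *)
have lenPQ j : j <= k -> k < Q j - P j.
  move=> jk; have := pext_addl A0 (i0 + j + l) (k - j).
  have := pext_addl B0 i0 j; rewrite -!PE.
  rewrite (_ : i0 + j + l + (k - j) = i0 + k + l); last by lia.
  rewrite -PE; move: PQ; rewrite /Q addn0; lia.
have arcPQ j : j < k.+1 -> short_arc n (P j) (Q j).
  move=> jk; have := lenPQ j jk; have := ok (i0 + j); rewrite -PE /short_arc /Q; lia.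
exists [set seg n_gt0 (P j) (Q j) | j : 'I_k.+1].
have PsiPQ j (O : F n) : j < k.+1 -> seg n_gt0 (P j) (Q j) \in val O ->
    (Psi O).1 = pext A (i0 + j + l) %% n :> nat /\
    (Psi O).2 = pext B (i0 + j) %% n :> nat.
  by move=> jk /(Psi_seg (arcPQ j jk)); rewrite PE /Q modnDr.
split; first exact: arcs_crossing.
- apply/subsetP => _ /imsetP[j _ ->].
  by rewrite seg_Omega ?arcPQ ?lenPQ // -ltnS.
- move=> _ O /imsetP[j _ ->] /PsiPQ[]// e1 e2.
  by apply/(N_pextP (ltn0Sn k) cardA cardB); exists (i0 + j).
- move=> w /(N_pextP (ltn0Sn k) cardA cardB)[i [e1 e2]].
  (* Chosen so that [i0 + j] is congruent to [i] mod [k.+1]; [i0 * k] stands for [- i0]. *)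
  pose j := (i + i0 * k) %% k.+1.
  have jk : j < k.+1 by rewrite ltn_pmod.
  exists (seg n_gt0 (P j) (Q j)); first by apply/imsetP; exists (Ordinal jk).
  move=> O /(PsiPQ _ _ jk)[f1 f2].
  have jE : exists t, i0 + j + t * k.+1 = i + i0 * k.+1.
    exists ((i + i0 * k) %/ k.+1); have := divn_eq (i + i0 * k) k.+1.
    by rewrite -/j mulnS; lia.
  case: jE => t tE.
  have modA : pext A (i0 + j + l) = pext A (i + l) %[mod n].
    rewrite -(modnDMr t) -(pextDM A0) cardA addnAC tE addnAC.
    by rewrite -cardA pextDM // modnDMr.
  have modB : pext B (i0 + j) = pext B i %[mod n].
    by rewrite -(modnDMr t) -(pextDM B0) cardB tE -cardB pextDM // modnDMr.
  case: w (Psi O) e1 e2 f1 f2 => w1 w2 [o1 o2] /= e1 e2 f1 f2.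
  by congr pair; apply: val_inj; rewrite /= ?e1 ?e2 ?f1 ?f2.
Qed.

End Crossing_of_N.

(** * Reading A and B off a crossing *)

Lemma modn_neq n a b : a < b < a + n -> a %% n <> b %% n.
Proof.
move=> /andP[ab ban] /eqP; rewrite eq_sym eqn_mod_dvd 1?ltnW // => /dvdn_leq.
by rewrite subn_gt0 => /(_ ab); lia.
Qed.

Section Crossing_to_N.
Variables (n s : nat) (n_gt0 : 0 < n) (s_gt1 : 1 < s).
Variables (X : {set {set 'I_(2 * n)}}) (f : {set 'I_(2 * n)} -> F n).
Hypotheses (crossX : crossing s X) (fX : forall S, S \in X -> S \in val (f S)).

Local Notation seg := (seg n_gt0).

(* Lifts of the members of X, and lifts of their images under the half-turn. *)
Let xarc p q := short_arc n p q && (seg p q \in X).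
Let yarc p q := xarc p q || xarc (p + n) (q + n).

Let xarcD p q : xarc (p + 2 * n) (q + 2 * n) = xarc p q.
Proof. by rewrite /xarc short_arcD seg_period. Qed.

Let yarcD p q : yarc (p + n) (q + n) = yarc p q.
Proof. by rewrite /yarc -!addnA addnn -mul2n xarcD orbC. Qed.

Let yarcDM p q t : yarc (p + t * n) (q + t * n) = yarc p q.
Proof.
elim: t => [|t IH]; first by rewrite !mul0n !addn0.
by rewrite mulSn (addnC n) !addnA yarcD.
Qed.

Let xarc_cross p q p' q' : xarc p q -> xarc p' q' -> p <= p' <= p + n ->
  seg p q = seg p' q' \/ [&& p < p', p' < q & q < q'].
Proof.
move=> /andP[a pX] /andP[a' pX'] pp.
have [->|ne] := eqVneq (seg p q) (seg p' q'); [by left|right].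
rewrite -(cross_seg n_gt0 a a' pp).
have /and3P[_ _ /forall_inP/(_ _ pX)/forall_inP/(_ _ pX')] := crossX.
by rewrite ne.
Qed.

(** The arcs start [n] apart, so a crossing would need [p + n < q]; hence both lift one segment, a
    diameter. *)
Let xarc_half p q : xarc p q -> xarc (p + n) (q + n) -> q = p + n.
Proof.
move=> x x'; have [|E|] := xarc_cross x x' _; [by lia| |].
  move: x x' => /andP[a _] /andP[a' _].
  by move/eqP: E; rewrite seg_eq //; lia.
by move: x => /andP[]; rewrite /short_arc; lia.
Qed.

Let xarc_lift S : S \in X -> exists p q, [/\ p < 2 * n, xarc p q & S = seg p q].
Proof.
move=> SX; have /and3P[/subsetP/(_ _ SX) SS _ _] := crossX.
have [p [q [p2 a E]]] := segmentP n_gt0 SS.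
by exists p, q; split=> //; rewrite /xarc a -E.
Qed.

Let Psi_f p q : xarc p q -> ((Psi (f (seg p q))).1 = p.+1 %% n :> nat) /\
                           ((Psi (f (seg p q))).2 = q %% n :> nat).
Proof. by case/andP=> a pX; apply: (Psi_seg a) (fX pX). Qed.

Let pair_lift S T : S \in X -> T \in X -> S != T ->
  exists p q p' q', [/\ xarc p q, xarc p' q',
    (S = seg p q /\ T = seg p' q') \/ (T = seg p q /\ S = seg p' q') &
    [&& p < p', p' < q & q < q']].
Proof.
move=> SX TX.
have [p [q [p2 x SE]]] := xarc_lift SX; have [p' [q' [p2' x' TE]]] := xarc_lift TX.
wlog pp : S T SX TX p q p' q' p2 p2' x x' SE TE / p <= p' => [H|].
  case/orP: (leq_total p p') => pp; first exact: (H S T _ _ p q p' q').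
  rewrite eq_sym => ST.
  have [a [b [a' [b' [xa xa' E lt]]]]] := H T S TX SX p' q' p q p2' p2 x' x TE SE pp ST.
  by exists a, b, a', b'; split=> //; case: E; [right|left].
have [pp'|pp'] := leqP p' (p + n) => ST.
  have ppn : p <= p' <= p + n by rewrite pp.
  have [E|lt] := xarc_cross x x' ppn; first by rewrite SE TE E eqxx in ST.
  by exists p, q, p', q'; split=> //; left.
(* Moving the first arc once around makes it the later one, starting at most [n] after the other. *)
have ppn : p' <= p + 2 * n <= p' + n by lia.
have x2 : xarc (p + 2 * n) (q + 2 * n) by rewrite xarcD.
have [E|lt] := xarc_cross x' x2 ppn.
  by rewrite SE TE E seg_period eqxx in ST.
exists p', q', (p + 2 * n), (q + 2 * n); split=> //; right.
by rewrite seg_period.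
Qed.

Let A := [set (Psi (f S)).1 | S in X].
Let B := [set (Psi (f S)).2 | S in X].

Let cardX : #|X| = s. Proof. by have /and3P[_ /eqP] := crossX. Qed.

(** Crossing arcs satisfy [p < p' < q <= p + n], so their starts differ mod [n]. *)
Let cardA : #|A| = s.
Proof.
rewrite card_in_imset // => S T SX TX /(congr1 val) /= E.
apply/eqP/negPn/negP => /(pair_lift SX TX)[p [q [p' [q' [x x' ST lt]]]]].
have bad : p.+1 %% n = p'.+1 %% n.
  rewrite -(Psi_f x).1 -(Psi_f x').1.
  by case: ST => -[<- <-]; rewrite E.
by apply: modn_neq bad; case/andP: x; rewrite /short_arc; lia.
Qed.

(** Crossing arcs satisfy [q < q' <= p' + n < q + n], so their ends differ mod [n]. *)
Let cardB : #|B| = s.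
Proof.
rewrite card_in_imset // => S T SX TX /(congr1 val) /= E.
apply/eqP/negPn/negP => /(pair_lift SX TX)[p [q [p' [q' [x x' ST lt]]]]].
have bad : q %% n = q' %% n.
  rewrite -(Psi_f x).2 -(Psi_f x').2.
  by case: ST => -[<- <-]; rewrite E.
by apply: modn_neq bad; case/andP: x'; rewrite /short_arc; lia.
Qed.

Let yarc_short p q : yarc p q -> short_arc n p q.
Proof. by case/orP=> /andP[]; rewrite ?short_arcD. Qed.

(** If just one of the arcs needs the half-turn to lie in [X], then, up to a common translation, the
    first arc moved by [n] crosses the second, so [q <= p + n < q']. *)
Let yarc_lt p q p' q' : yarc p q -> yarc p' q' -> p < p' < p + n -> q < q'.
Proof.
have key a b a' b' : xarc a b -> xarc a' b' -> a < a' < a + n -> a' < b < b'.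
  move=> x x' lt; have [|E|] := xarc_cross x x' _; [by lia| |by lia].
  move: x x' => /andP[sa _] /andP[sa' _].
  by move/eqP: E; rewrite seg_eq //; lia.
move=> y y' pp; have sh := yarc_short y; have sh' := yarc_short y'.
move: sh sh'; rewrite /short_arc => sh sh'.
case/orP: y => x; case/orP: y' => x'.
- by have := key _ _ _ _ x x' _; lia.
- rewrite -xarcD in x; have := key _ _ _ _ x' x _; lia.
- by have := key _ _ _ _ x' x _; lia.
- by have := key _ _ _ _ x x' _; lia.
Qed.

Let yarc_fun p q q' : yarc p q -> yarc p q' -> q = q'.
Proof.
have key a b b' : xarc a b -> xarc a b' -> b = b'.
  move=> x x'; have [|E|] := xarc_cross x x' _; [by lia| |by lia].
  move: x x' => /andP[sa _] /andP[sa' _].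
  by move/eqP: E; rewrite seg_eq //; lia.
have key' a b b' : xarc a b -> xarc (a + n) (b' + n) -> b = b'.
  move=> x x'; have [|E|] := xarc_cross x x' _; [by lia| |].
    move: x x' => /andP[sa _] /andP[sa' _].
    by move/eqP: E; rewrite seg_eq //; lia.
  by case/andP: x; rewrite /short_arc; lia.
case/orP=> x /orP[]x'; [exact: key x x'|exact: key' x x'|by rewrite (key' _ _ _ x' x)|].
by have := key _ _ _ x x'; lia.
Qed.

(** Modulo [n] each [pext A i] is one more than a starting point, and translation by [n] preserves
    [yarc], so the arc can be moved to any lift. The [+ n] keeps the predecessor from being
    truncated. *)
Let yarc_ex i : exists q, yarc (pext A i + n).-1 q.
Proof.
have A0 : 0 < #|A| by rewrite cardA; lia.
have [x /imsetP[S SX ->] E] := pext_mod A0 i.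
have [p [q [p2 xp SE]]] := xarc_lift SX.
have y : yarc p q by rewrite /yarc xp.
have := (Psi_f xp).1; rewrite -SE -E.
have -> : pext A i = pext A i + n %[mod n] by rewrite modnDr.
set m := pext A i + n; have mE : m.-1.+1 = m by rewrite prednK // /m; lia.
rewrite -{1}mE; move: (m.-1) => {E mE}m' /eqP.
rewrite -(addn1 m') -(addn1 p) eqn_modDr => /eqP E.
have := divn_eq m' n; rewrite E; move: (m' %/ n) => t; have := divn_eq p n.
have : p %/ n < 2 by rewrite ltn_divLR.
have := yarc_short y; rewrite /short_arc.
case: (p %/ n) => [|[|//]] sh _.
  rewrite mul0n add0n => <- ->; exists (q + t * n).
  by rewrite addnC yarcDM.
rewrite mul1n => pE ->; exists (q - n + t * n).
by rewrite addnC yarcDM -yarcD addnC -pE subnK //; lia.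
Qed.

Let yarc_mem p q : yarc p q -> exists2 S, S \in X &
  ((Psi (f S)).1 = p.+1 %% n :> nat) /\ ((Psi (f S)).2 = q %% n :> nat).
Proof.
case/orP=> x; have := Psi_f x; case/andP: (x) => _ SX.
  by exists (seg p q).
by rewrite -addSn !modnDr; exists (seg (p + n) (q + n)).
Qed.

(** The witnesses collect the first and the second coordinates of [Psi] on [X]; it remains to see
    that [X] matches them by the least admissible shift. *)
Lemma crossing_N : exists A B : {set 'I_n}, [/\ #|A| = s, #|B| = s &
  forall w, w \in N A B -> exists2 S, S \in X & Psi (f S) = w].
Proof.
exists A, B; split=> //.
have s_gt0 : 0 < s by lia.
have A0 : 0 < #|A| by rewrite cardA.
have B0 : 0 < #|B| by rewrite cardB.
pose p i := (pext A i + n).-1; pose Q i := xchoose (yarc_ex i).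
have yQ i : yarc (p i) (Q i) by apply: xchooseP (yarc_ex i).
have pE i : (p i).+1 = pext A i + n by rewrite /p prednK //; lia.
have pD i : p (i + s) = p i + n.
  by apply: succn_inj; rewrite pE -{1}cardA pextD // -addSn pE.
have QD i : Q (i + s) = Q i + n.
  by apply: (@yarc_fun (p (i + s))) => //; rewrite pD yarcD.
have pS i : p i < p i.+1 < p i + n.
  rewrite -pD -(ltnS (p i).+1) -(ltnS (p i.+1).+1) !pE !ltn_add2r !pext_lt //; lia.
have QS i : Q i < Q i.+1 by apply: yarc_lt (yQ i) (yQ i.+1) (pS i).
have shQ i : p i < Q i <= p i + n := yarc_short (yQ i).
have exC i : exists j, pext B j == Q i.
  have [S SX [_ E]] := yarc_mem (yQ i).
  have [|j jE] := @pext_surj _ B B0 (Q i) n_gt0; last by exists j; apply/eqP.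
  by exists (Psi (f S)).2 => //; apply: imset_f.
pose C i := xchoose (exC i).
have CE i : pext B (C i) = Q i by apply/eqP/(xchooseP (exC i)).
have CS i : C i < C i.+1 by rewrite -(pext_lt B0) !CE.
have CD i : C (i + s) = C i + s.
  by apply: (pext_inj B0); rewrite CE QD -{1}cardB pextD // CE.
have Cadd i j : C i + j <= C (i + j).
  elim: j => [|j IH]; first by rewrite !addn0.
  by rewrite !addnS; apply: leq_ltn_trans IH (CS _).
pose c := C 0.
(* [C] is strictly increasing and [C (i + s) = C i + s], which forces steps of 1. *)
have QE i : Q i = pext B (c + i).
  rewrite -CE; congr pext; elim: i => [|i IH]; first by rewrite addn0.
  have := Cadd i.+1 s.-1; rewrite (_ : i.+1 + s.-1 = i + s) ?CD; last by lia.
  by have := CS i; rewrite addnS -IH; lia.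
have c_ge : s <= c.
  have : pext B s.-1 < pext B c.
    rewrite -[c]addn0 -QE; have := pext_bound B0 s.-1.
    rewrite cardB divn_small; last by lia.
    by have := shQ 0; have := pE 0; lia.
  by rewrite pext_lt //; lia.
have c_le : c <= 2 * s.
  have : pext B (c + s.-1) < pext B (0 + 3 * #|B|).
    rewrite -QE pextDM //; have := pext_bound A0 s.-1.
    rewrite cardA divn_small; last by lia.
    by have := shQ s.-1; have := pE s.-1; lia.
  by rewrite pext_lt // cardB; lia.
(* With this offset [Q (i + l)] is [pext B i + 2 * n], so [X] matches [pext A (i + l)] with
   [pext B i]; the bounds on [c] give [l <= s]. *)
pose l := 2 * s - c.
have pext2 i : pext B (c + (i + l)) = pext B i + 2 * n.
  by rewrite -pextDM // cardB; congr pext; rewrite /l; lia.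
have ok : shift_ok A B l.
  apply/(shift_okP s_gt0 cardA cardB) => [|i]; first by rewrite /l; lia.
  have := pext2 i; rewrite -QE; have := shQ (i + l); have := pE (i + l); lia.
have min l' : l' < l -> ~~ shift_ok A B l'.
  move=> l'l; have l's : l' <= s by rewrite /l in l'l; lia.
  apply/negP => /(shift_okP s_gt0 cardA cardB l's) ok'.
  (* Arc [j + 1] would end no later than arc [j] moved by [n] starts, so these two could not cross.
     Hence [X] would contain arcs [j] and [j + 1] in the same lift. *)
  have Qle j : Q j.+1 <= p j + n.
    have h := ok' (c + j.+1); rewrite -QE in h.
    have : pext A (c + j.+1 + l') <= pext A (j + 2 * #|A|).
      by rewrite leqNgt pext_lt // cardA -leqNgt; rewrite /l in l'l; lia.
    by rewrite pextDM //; have := pE j; lia.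
  have step j : xarc (p j) (Q j) -> xarc (p j.+1) (Q j.+1).
    move=> x; case/orP: (yQ j.+1) => // x'.
    have := pS j; have := Qle j => Qj pj.
    rewrite -xarcD in x; have [|E|] := xarc_cross x' x _; [by lia| |by lia].
    move: x x' => /andP[sa _] /andP[sa' _].
    by move/eqP: E; rewrite seg_eq //; lia.
  have [i0 x0] : exists i, xarc (p i) (Q i).
    by case/orP: (yQ 0) => x; [exists 0|exists (0 + s); rewrite pD QD].
  have xj j : xarc (p (i0 + j)) (Q (i0 + j)).
    by elim: j => [|j IH]; rewrite ?addn0 // addnS; apply: step.
  (* One period later the arc has moved by [n], so [X] contains its half-turn too; by [xarc_half] it
     is a diameter, against [Qle i0]. *)
  have x1 : xarc (p (i0 + 1) + n) (Q (i0 + 1) + n) by rewrite -pD -QD -addnA.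
  by have := xarc_half (xj 1) x1; have := Qle i0; have := pS i0; rewrite addn1; lia.
have lE : shift A B = l.
  have [_ ok1 min1] := shift_min B cardA.
  apply/eqP; rewrite eqn_leq; apply/andP; split; rewrite leqNgt; apply/negP => h.
    by move: (min1 _ h); rewrite ok.
  by move: (min _ h); rewrite ok1.
move=> w /(N_pextP s_gt0 cardA cardB)[i []]; rewrite lE => e1 e2.
have [S SX [f1 f2]] := yarc_mem (yQ (i + l)).
exists S => //; move: f1 f2; rewrite pE QE pext2 modnDr modnDMr.
case: w e1 e2 (Psi (f S)) => w1 w2 /= e1 e2 [o1 o2] /= f1 f2.
by congr pair; apply: val_inj; rewrite /= ?e1 ?e2 ?f1 ?f2.
Qed.

End Crossing_to_N.

(** * Vertices and nonfaces of the complex *)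

Section Vertices.
Variables (n : nat) (n_gt0 : 0 < n).

Lemma seg_orbit_seg p q : seg_orbit (seg n_gt0 p q) =
  [set seg n_gt0 p q; seg n_gt0 (p + n) (q + n)].
Proof. by rewrite /seg_orbit seg_rotate. Qed.

(** The residues of [p + 1] and [q] mod [n] fix a short arc up to translation by multiples of [n],
    that is, up to half-turns. *)
Lemma Psi_inj : injective (@Psi n).
Proof.
have orb (O : F n) : exists p q, [/\ p < 2 * n, short_arc n p q &
    val O = seg_orbit (seg n_gt0 p q)].
  case: O => O OS; have /imsetP[S SS OE] := OS.
  have [p [q [p2 a SE]]] := segmentP n_gt0 SS.
  by exists p, q; split=> //=; rewrite OE SE.
move=> O O' E; apply: val_inj.
have [p [q [p2 a OE]]] := orb O; have [p' [q' [p2' a' OE']]] := orb O'.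
have inO (P : F n) u v : val P = seg_orbit (seg n_gt0 u v) ->
    seg n_gt0 u v \in val P.
  by move=> ->; rewrite !inE eqxx.
have [e1 e2] := Psi_seg a (inO _ _ _ OE).
have [e1' e2'] := Psi_seg a' (inO _ _ _ OE').
have {e1 e1'} e1 : p.+1 %% n = p'.+1 %% n by rewrite -e1 -e1' E.
have {e2 e2'} e2 : q %% n = q' %% n by rewrite -e2 -e2' E.
rewrite {}OE {}OE' {O O' E inO orb}.
wlog pp : p q p' q' p2 p2' a a' e1 e2 / p <= p' => [H|].
  by case/orP: (leq_total p p') => pp; [|apply: esym]; apply: H.
have {e1} : p' = p \/ p' = p + n.
  have [lt1|ge1] := ltnP p' (p + n).
    left; apply/eqP; rewrite eq_sym eqn_leq pp leqNgt; apply/negP => lt.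
    by apply: modn_neq e1; lia.
  right; apply/eqP; rewrite eq_sym eqn_leq ge1 leqNgt; apply/negP => lt.
  have : (p + n).+1 %% n = p'.+1 %% n by rewrite -e1 -addSn modnDr.
  by apply: modn_neq; lia.
move: a a'; rewrite /short_arc => a a' [pE|pE].
  have -> : q' = q; last by rewrite pE.
  by case: (ltngtP q q') => // lt; [have := modn_neq _ e2|have := modn_neq _ (esym e2)];
     lia.
have -> : q' = q + n.
  have e3 : (q + n) %% n = q' %% n by rewrite modnDr.
  by case: (ltngtP (q + n) q') => // lt;
     [have := modn_neq _ e3|have := modn_neq _ (esym e3)]; lia.
by rewrite pE !seg_orbit_seg setUC -!addnA addnn -mul2n seg_period.
Qed.

Lemma Psi_vertex_inj k : injective (@Psi_vertex n k).
Proof. by move=> v v' /(congr1 val) E; apply: val_inj; apply: Psi_inj E. Qed.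

Lemma Psi_vertex_surj k (w : var_index n k) : exists v, w = Psi_vertex v.
Proof.
have /imsetP[O OF wE] := valP w.
by exists (exist _ O OF); apply: val_inj.
Qed.

Lemma Omega_vertex k S : S \in Omega n k ->
  exists v : Fk_vertex n k, S \in val (val v).
Proof.
move=> SO; have SS : S \in segments n by move: SO; rewrite inE => /andP[].
pose O : F n := exist _ (seg_orbit S) (imset_f _ SS).
have OF : O \in Fk n k by rewrite inE; apply: imset_f.
by exists (exist _ O OF); rewrite /= !inE eqxx.
Qed.

(** The crossing built from [A] and [B] lies in [Omega], so its orbits are vertices. Thus [mAB] is
    the product over all of [N A B]. *)
Lemma N_sub_Psi k (A B : {set 'I_n}) : #|A| = k.+1 -> #|B| = k.+1 ->
  N A B \subset [set Psi v | v in Fk n k].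
Proof.
move=> cA cB; have [X [_ /subsetP XO _ XN]] := N_crossing n_gt0 cA cB.
apply/subsetP => w /XN[S SX Sw]; have [v Sv] := Omega_vertex (XO _ SX).
by rewrite -(Sw _ Sv) imset_f // (valP v).
Qed.

Lemma N_nonface k (A B : {set 'I_n}) : #|A| = k.+1 -> #|B| = k.+1 ->
  [set v : Fk_vertex n k | Psi (val v) \in N A B] \notin Dstar n k.
Proof.
move=> cA cB; have [X [crX /subsetP XO XN _]] := N_crossing n_gt0 cA cB.
rewrite inE negbK; apply/existsP; exists X; rewrite crX andbT.
apply/subsetP => S SX; have [v Sv] := Omega_vertex (XO _ SX).
by apply/bigcupP; exists v => //; rewrite inE (XN _ _ SX).
Qed.

Lemma nonface_N k (E : {set Fk_vertex n k}) : 0 < k -> E \notin Dstar n k ->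
  exists A B : {set 'I_n}, [/\ #|A| = k.+1, #|B| = k.+1 &
    forall w, w \in N A B -> exists2 v, v \in E & Psi (val v) = w].
Proof.
move=> k_gt0; rewrite inE negbK => /existsP[X /andP[/subsetP XE crX]].
have [S0 S0X] : exists S, S \in X.
  by apply/set0Pn; rewrite -card_gt0; have /and3P[_ /eqP-> _] := crX.
have [v0 v0E S0v] := bigcupP (XE _ S0X).
have [f fP] : exists f : {set 'I_(2 * n)} -> Fk_vertex n k,
    forall S, S \in X -> f S \in E /\ S \in val (val (f S)).
  apply: (fin_all_exists (P := fun S v => S \in X -> v \in E /\ S \in val (val v))) => S.
  have [/XE/bigcupP[v vE Sv]|nSX] := boolP (S \in X); last by exists v0.
  by exists v.
have [|A [B [cA cB AB]]] :=
  @crossing_N n k.+1 n_gt0 _ X (fun S => val (f S)) crX (fun S SX => (fP S SX).2).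
  by rewrite ltnS.
exists A, B; split=> // w /AB[S SX Sw]; exists (f S) => //.
exact: (fP S SX).1.
Qed.

End Vertices.

(** * Comparison of generators *)

Section IdealGenerators.
Import GRing.Theory.
Local Open Scope ring_scope.

Lemma ideal_gen_sub (R : comPzRingType) (G G' : R -> Prop) :
  (forall m, G m -> exists a, exists2 m', G' m' & m = a * m') ->
  forall p, ideal_gen G p -> ideal_gen G' p.
Proof.
move=> GG' p [s [Gs ->]] {p}; elim: s Gs => [|[c m] s IH] Gs.
  by exists [::]; rewrite !big_nil.
have [|t [Gt E]] := IH; first by move=> d ds; apply: Gs; rewrite inE ds orbT.
have [|a [m' Gm' mE]] := GG' m; first by apply: (Gs (c, m)); rewrite inE eqxx.
exists ((c * a, m') :: t); split=> [d|]; last first.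
  by rewrite !big_cons E /= mE mulrA.
by rewrite inE => /orP[/eqP->|/Gt].
Qed.

Lemma prod_Psi_vertex (K : fieldType) n k (E : {set Fk_vertex n k}) : (0 < n)%N ->
  \prod_(v in E) xvar K (Psi_vertex v) =
  \prod_(w in [set Psi_vertex v | v in E]) xvar K w.
Proof.
by move=> n_gt0; rewrite big_imset //= => v v' _ _ /(Psi_vertex_inj n_gt0).
Qed.

End IdealGenerators.

Theorem theorem3p7 (K : fieldType) (n k : nat) (hn : 2 <= n)
    (hk : 1 <= k <= n - 1) :
  (forall A B : {set 'I_n}, #|A| = k.+1 -> #|B| = k.+1 ->
     N A B \subset [set Psi v | v in Fk n k]) /\
  (forall p : {mpoly K[#|{: var_index n k}|]},
     stanley_reisner (Dstar n k) (fun v => xvar K (Psi_vertex v)) p <->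
     ideal_gen (fun m => exists A B : {set 'I_n},
                  [/\ #|A| = k.+1, #|B| = k.+1 & m = mAB K k A B]) p).
Proof.
have n_gt0 : 0 < n by apply: ltnW.
have k_gt0 : 0 < k by case/andP: hk.
split=> [A B|p]; first exact: N_sub_Psi.
split; apply: ideal_gen_sub => m.
  case=> E /(nonface_N n_gt0 k_gt0)[A [B [cA cB ABE]]] ->.
  (* The cofactor of [mAB] consists of the variables of [E] outside [N A B]. *)
  rewrite prod_Psi_vertex // (bigID (fun w => val w \in N A B)) /= GRing.mulrC.
  eexists; exists (mAB K k A B); first by exists A, B.
  congr GRing.mul; apply: eq_bigl => w; apply: andb_idl => /ABE[v vE vw].
  by apply/imsetP; exists v => //; apply: val_inj.
(* [m] is itself the monomial of a nonface, so the cofactor is 1. *)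
case=> A [B [cA cB ->]]; exists 1%R.
exists (\prod_(v in [set v : Fk_vertex n k | Psi (val v) \in N A B])
          xvar K (Psi_vertex v))%R.
  by exists [set v : Fk_vertex n k | Psi (val v) \in N A B] => //; apply: N_nonface.
rewrite GRing.mul1r prod_Psi_vertex //; apply: eq_bigl => w.
have [v ->] := Psi_vertex_surj w.
by rewrite mem_imset ?inE //; apply: Psi_vertex_inj.
Qed.
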